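(* Let $\mathbb{K}$ be a field of characteristic $0$ and $s\ge 1$. For any family $F=\{(x-a_i)^{e_i} : 1\le i\le s\}$ with $a_i\in\mathbb{K}$, $e_i\in\mathbb{N}$, the pairs $(a_i,e_i)$ pairwise distinct, satisfying the Pólya condition, we have $$\dim\langle F\rangle\ \ge\ \left(1-\frac{\sqrt2}{2}\right)(s-1).$$
   Context: $\mathbb{N}$ contains $0$. The family $F$ satisfies the Pólya condition if, with $n_i=|\{j : e_j<i\}|$, one has $n_i\le i$ for all integers $i\ge 0$. $\langle F\rangle$ denotes the $\mathbb{K}$-vector space of polynomials spanned by $F$. *)

(* Defs.v *)
From HB Require Import structures.
From mathcomp Require Import all_boot all_order all_algebra.

Set Implicit Arguments.
Unset Strict Implicit.
Unset Printing Implicit Defensive.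

Import Order.TTheory GRing.Theory Num.Theory.
Local Open Scope ring_scope.

Definition shifted_powers (K : fieldType) (s : nat)
    (a : 'I_s -> K) (e : 'I_s -> nat) : seq {poly K} :=
  [seq ('X - (a i)%:P) ^+ e i | i : 'I_s].

(* The cardinal is over indices j, so equal exponents are counted with
   multiplicity. *)
Definition polya_condition (s : nat) (e : 'I_s -> nat) : Prop :=
  forall i : nat, (#|[set j : 'I_s | (e j < i)%N]| <= i)%N.

Definition max_size (K : fieldType) (F : seq {poly K}) : nat :=
  \max_(p <- F) size p.

(* {poly K} is not finite-dimensional, hence not a vectType; the span is taken
   inside the subspace {poly_n K} of polynomials of size at most n, where n is
   large enough for npolyp n to truncate no member of F (max_size_npolypK). *)
Definition dim_poly_span (K : fieldType) (F : seq {poly K}) : nat :=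
  \dim <<[seq npolyp (max_size F) p | p <- F]>>%VS.

Lemma max_size_npolypK (K : fieldType) (F : seq {poly K}) (p : {poly K}) :
  p \in F -> npolyp (max_size F) p = p :> {poly K}.
Proof.
by move=> pF; apply: npolypK; rewrite /max_size (big_rem p) //= leq_maxl.
Qed.

(* Main.v *)
Require Import Defs.
From HB Require Import structures.
From mathcomp Require Import all_boot all_order all_algebra.
From mathcomp Require Import zify lra.

Set Implicit Arguments.
Unset Strict Implicit.
Unset Printing Implicit Defensive.

Import Order.TTheory GRing.Theory Num.Theory.
Local Open Scope ring_scope.

(** The bound holds with the better constant 1/3: writing k for the dimension
of the span of the family, one has s <= 3k, and sqrt 2 >= 4/3 turns this into
the stated inequality.

The idea is to look for a nonzero linear differential operator
L = sum_(i <= 2k) P_i D^i with polynomial coefficients that annihilates the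
whole family, its coefficients being so small in degree that it has too few
solutions of the form (X - a)^e.

On the one hand, few solutions. Suppose that L has order n. If e >= n and
L kills (X - a)^e, then a is a root of the leading coefficient P_n; and if
several exponents e >= n occur with the same node a, then a is a root of P_n of
at least that multiplicity ([exp_dvdp_lead]). So at most deg P_n members of the
family have an exponent >= n, while the Pólya condition leaves at most n members
with an exponent < n. Hence s <= n + deg P_n ([card_solutions_lt]), and if
size P_i <= 3k + 1 - i for all i, then s <= 3k whatever the order n is. This is
why the degree bounds decrease with i: the order of L is not under control.

On the other hand, such an L exists by counting ([exists_annihilator]). It
suffices to kill k members of the family that form a basis of the span. When
also size P_i <= i + k + 1, applying L to (X - a)^e gives (X - a)^(e - 2k)
(truncated subtraction) times a polynomial of size at most 3k + 1, so each basis
element costs at most 3k + 1 linear equations, k(3k + 1) in total. The bounds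
min(i + k + 1, 3k + 1 - i), for 0 <= i <= 2k, sum to more than k(3k + 1)
([sum_size_bounds]), so there are more unknown coefficients than equations. *)

(** * Linear algebra *)

Lemma underdetermined_system (K : fieldType) (T U : finType) (A : {set T})
    (F : T -> U -> K) :
  (#|U| < #|A|)%N ->
  exists c : T -> K, (exists2 x, x \in A & c x != 0) /\
    forall y, \sum_(x in A) c x * F x y = 0.
Proof.
move=> ltUA.
pose M := \matrix_(i < #|A|, j < #|U|) F (enum_val i) (enum_val j).
have /rowV0Pn [u /sub_kermxP uM0 u_neq0] : kermx M != 0.
  by rewrite kermx_eq0 /row_free neq_ltn (leq_ltn_trans (rank_leq_col M)).
pose c x := \sum_(i < #|A| | enum_val i == x) u 0 i.
have cE i : c (enum_val i) = u 0 i.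
  by rewrite /c (big_pred1 i) // => j /=; rewrite (inj_eq enum_val_inj).
exists c; split=> [|y].
  have /rV0Pn [i ui_neq0] := u_neq0.
  by exists (enum_val i); rewrite ?enum_valP ?cE.
rewrite big_enum_val /=.
have := congr1 (fun B : 'rV_ _ => B 0 (enum_rank y)) uM0.
rewrite !mxE => uMy; rewrite -[RHS]uMy; apply: eq_bigr => i _.
by rewrite cE mxE enum_rankK.
Qed.

(** The basis has to be extracted from the family itself, and through indices,
since the count of equations uses the shape (X - a)^e of each basis element. *)
Lemma free_subfamily (K : fieldType) (vT : vectType K) (I : eqType)
    (v : I -> vT) (r : seq I) :
  exists J : seq I, free [seq v i | i <- J] /\
    <<[seq v i | i <- J]>>%VS = <<[seq v i | i <- r]>>%VS.
Proof.
elim: r => [|i r [J [freeJ spanJ]]]; first by exists [::]; rewrite nil_free.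
have [vi_in|vi_notin] := boolP (v i \in <<[seq v j | j <- J]>>%VS).
  exists J; split=> //=; rewrite span_cons -spanJ.
  by apply/esym/addv_idPr; rewrite -memvE.
by exists (i :: J); split; rewrite /= ?free_cons ?vi_notin // !span_cons spanJ.
Qed.

(** * Differential operators annihilating shifted powers *)

Definition diffop (K : fieldType) (n : nat) (P : nat -> {poly K})
    (f : {poly K}) : {poly K} :=
  \sum_(i < n) P i * f^`(i).

Lemma diffop_comb (K : fieldType) n (P : nat -> {poly K}) (I : finType)
    (c : I -> K) (f : I -> {poly K}) :
  diffop n P (\sum_i c i *: f i) = \sum_i c i *: diffop n P (f i).
Proof.
rewrite /diffop.
under [RHS]eq_bigr => i _ do rewrite scaler_sumr.
rewrite exchange_big /=; apply: eq_bigr => i _.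
rewrite (linear_sum (derivn i)) mulr_sumr; apply: eq_bigr => j _.
by rewrite linearZ /= -scalerAr.
Qed.

Lemma derivn_XsubC_exp (K : fieldType) (a : K) e i :
  (('X - a%:P) ^+ e)^`(i) = ('X - a%:P) ^+ (e - i) *+ e ^_ i.
Proof.
elim: i => [|i IHi]; first by rewrite derivn0 subn0 ffactn0 mulr1n.
rewrite derivnS IHi derivMn deriv_exp derivXsubC mul1r -mulrnA subnS.
by rewrite mulnC ffactnSr.
Qed.

(** For i <= t the i-th derivative of (X - a)^e is a multiple of
(X - a)^(e - t); after division by this common factor, the hypothesis on [d]
keeps the image of (X - a)^e under the operator within size t + l + 1. Each
shifted power therefore imposes t + l + 1 linear equations on the coefficients
of the [P i], however large e is. *)
Lemma exists_annihilator (K : fieldType) (t l : nat) (d : nat -> nat)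
    (fs : seq (K * nat)) :
  (forall i, (d i <= i + l.+1)%N) ->
  (size fs * (t + l).+1 < \sum_(i < t.+1) d i)%N ->
  exists P : nat -> {poly K}, [/\ forall i, (size (P i) <= d i)%N,
    exists i : 'I_t.+1, P i != 0 &
    forall a e, (a, e) \in fs -> diffop t.+1 P (('X - a%:P) ^+ e) = 0].
Proof.
move=> le_d lt_fs; set m := (t + l).+1.
have le_dm (i : 'I_t.+1) : (d i <= m)%N.
  by apply: leq_trans (le_d i) _; rewrite addnS ltnS leq_add2r -ltnS.
(* [g f i] is the i-th derivative of (X - a)^e divided by (X - a)^(e - t). *)
pose g (f : K * nat) i : {poly K} :=
  (f.2 ^_ i)%:R *: ('X - f.1%:P) ^+ (minn f.2 t - i).
pose A := [set x : 'I_t.+1 * 'I_m | (x.2 < d x.1)%N].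
pose coefs (x : 'I_t.+1 * 'I_m) (y : 'I_(size fs) * 'I_m) : K :=
  ('X^(x.2) * g (nth (0, 0%N) fs y.1) x.1)`_y.2.
have cardA : #|A| = (\sum_(i < t.+1) d i)%N.
  transitivity (\sum_(i < t.+1) \sum_(j < m | (j < d i)%N) 1)%N.
    by rewrite pair_big_dep -sum1_card; apply: eq_bigl => x; rewrite inE.
  apply: eq_bigr => i _.
  by rewrite (big_ord_narrow (le_dm i)) sum1_card card_ord.
have [|c [[[i0 j0] ij0A c_neq0] cF0]] := underdetermined_system (A := A) coefs.
  by rewrite cardA card_prod !card_ord.
pose P i : {poly K} := \sum_(j < m | (j < d i)%N) c (inord i, j) *: 'X^j.
have sizeP i : (size (P i) <= d i)%N.
  apply: leq_trans (size_sum _ _ _) _; apply/bigmax_leqP => j lt_jd.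
  by rewrite (leq_trans (size_scale_leq _ _)) ?size_polyXn.
exists P; split=> //.
  exists i0; apply: contraNneq c_neq0 => /(congr1 (fun p : {poly K} => p`_j0)).
  rewrite coef0 coef_sum (bigD1 j0) /=; last by move: ij0A; rewrite inE.
  rewrite coefZ coefXn eqxx mulr1 inord_val big1 ?addr0 => [->//|j].
  case/andP=> _ neq_j; rewrite coefZ coefXn eq_sym.
  by rewrite (inj_eq val_inj) (negPf neq_j) mulr0.
move=> a e fs_ae; pose f := (a, e).
have gE (i : 'I_t.+1) :
    (('X - a%:P) ^+ e)^`(i) = ('X - a%:P) ^+ (e - t) * g f i.
  rewrite derivn_XsubC_exp /g /= -scalerAr -exprD scaler_nat.
  have [lt_ei|le_ie] := ltnP e i; first by rewrite ffact_small ?mulr0n.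
  by congr (_ ^+ _ *+ _); have := ltn_ord i; lia.
suff Pg0 : \sum_(i < t.+1) P i * g f i = 0.
  rewrite /diffop; under eq_bigr => i _ do rewrite gE mulrCA.
  by rewrite -mulr_sumr Pg0 mulr0.
(* Coefficients from m on vanish by the size bound, the others because they are
the equations that c solves. *)
apply/polyP=> w; rewrite coef0; have [le_mw|lt_wm] := leqP m w.
  apply/nth_default/(leq_trans _ le_mw)/(leq_trans (size_sum _ _ _)).
  apply/bigmax_leqP => i _; have [lt_ei|le_ie] := ltnP e i.
    by rewrite /g ffact_small // scale0r mulr0 size_poly0.
  apply: leq_trans (size_polyMleq _ _) _.
  have sizeg : (size (g f i) <= (minn e t - i).+1)%N.
    by rewrite (leq_trans (size_scale_leq _ _)) ?size_exp_XsubC.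
  have := sizeP i; have := le_d i; have := ltn_ord i; rewrite /m; lia.
have b_lt : (index f fs < size fs)%N by rewrite index_mem.
rewrite coef_sum -[RHS](cF0 (Ordinal b_lt, Ordinal lt_wm)).
transitivity (\sum_(i < t.+1) \sum_(j < m | (j < d i)%N)
    c (i, j) * coefs (i, j) (Ordinal b_lt, Ordinal lt_wm)); last first.
  by rewrite pair_big_dep; apply: eq_big => [[i j]|[i j] _] //; rewrite inE.
apply: eq_bigr => i _; rewrite /P mulr_suml coef_sum; apply: eq_bigr => j _.
by rewrite inord_val -scalerAl coefZ /coefs /= nth_index.
Qed.

(** * Counting the solutions that are shifted powers *)

Lemma natr_inj_char0 (K : fieldType) :
  [pchar K] =i pred0 -> injective (fun n : nat => n%:R : K).
Proof.
move=> /pcharf0P natr_eq0 m n; wlog le_mn : m n / (m <= n)%N.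
  by move=> IH /= mn; case/orP: (leq_total m n) => /IH -> //.
move=> /= /esym /eqP; rewrite -subr_eq0 -natrB // natr_eq0 subn_eq0 => le_nm.
by apply/eqP; rewrite eqn_leq le_mn.
Qed.

(** The combination is the value at z of a polynomial of size at most n, which
vanishes at n distinct points and so is zero. Evaluating it at 0, 1, 2, ... then
kills the coefficients in turn, as the falling factorial of order i is 0 at
smaller integers and i! at i. *)
Lemma ffact_comb_eq0 (K : fieldType) (charK0 : [pchar K] =i pred0)
    (n : nat) (c : nat -> K) (zs : seq nat) :
  uniq zs -> (n <= size zs)%N ->
  (forall z, z \in zs -> \sum_(i < n) c i * (z ^_ i)%:R = 0) ->
  forall i, (i < n)%N -> c i = 0.
Proof.
move=> uniq_zs le_n zs0.
pose ff i : {poly K} := \prod_(j < i) ('X - (j%:R)%:P).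
have ffE i z : (ff i).[z%:R] = (z ^_ i)%:R.
  elim: i => [|i IHi]; first by rewrite /ff big_ord0 hornerC ffactn0.
  rewrite /ff big_ord_recr /= hornerM IHi hornerXsubC ffactnSr natrM.
  have [lt_zi|le_iz] := ltnP z i; first by rewrite ffact_small ?mul0r.
  by rewrite natrB.
pose p := \sum_(i < n) c i *: ff i.
have pE z : p.[z%:R] = \sum_(i < n) c i * (z ^_ i)%:R.
  by rewrite horner_sum; apply: eq_bigr => i _; rewrite hornerZ ffE.
have p0 : p = 0.
  apply: (@roots_geq_poly_eq0 _ p [seq z%:R | z <- zs]).
  - by apply/allP => _ /mapP [z zsz ->]; rewrite /root pE zs0.
  - by rewrite map_inj_uniq //; apply: natr_inj_char0.
  rewrite size_map; apply: leq_trans le_n; apply: leq_trans (size_sum _ _ _) _.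
  apply/bigmax_leqP => i _; rewrite (leq_trans (size_scale_leq _ _)) //.
  by rewrite size_prod_XsubC /index_enum -enumT size_enum_ord.
elim/ltn_ind=> i IHi lt_in.
have := pE i; rewrite p0 horner0 (bigD1 (Ordinal lt_in)) //= big1 ?addr0.
  move/esym/eqP; rewrite ffactnn mulf_eq0 => /orP [/eqP //|].
  by rewrite (proj1 (pcharf0P K) charK0) -leqn0 leqNgt fact_gt0.
move=> j neq_ji; have [lt_ij|le_ji] := ltnP i j.
  by rewrite ffact_small ?mulr0.
by rewrite IHi ?mul0r // ltn_neqAle le_ji andbT.
Qed.

(** After moving a to the origin and removing the factor X^(e - n), the equation
for an exponent e says that the sum over i <= n of the falling factorials
(e)_i times Q_i is 0, where Q_i = P_i X^(n - i). For v less than the number of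
exponents, read off the coefficient of X^v: it is an indicial polynomial, of
degree at most n in e. It vanishes at the given exponents, and also at
0, ..., n - v - 1 because X^(n - i) divides Q_i. These are more than n roots, so
it is zero, and X^v does not occur in Q_n = P_n. *)
Lemma exp_dvdp_lead (K : fieldType) (charK0 : [pchar K] =i pred0)
    (n : nat) (P : nat -> {poly K}) (a : K) (es : seq nat) :
  uniq es -> (forall e, e \in es -> (n <= e)%N) ->
  (forall e, e \in es -> diffop n.+1 P (('X - a%:P) ^+ e) = 0) ->
  ('X - a%:P) ^+ size es %| P n.
Proof.
move=> uniq_es le_n es0.
pose Q i := (P i \Po ('X + a%:P)) * 'X^(n - i).
have XsubC_shift j : ('X - a%:P) ^+ j \Po ('X + a%:P) = 'X^j.
  rewrite rmorphXn /= rmorphB /= comp_polyX comp_polyC.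
  by rewrite addrK.
have Q0 e : e \in es -> \sum_(i < n.+1) (e ^_ i)%:R *: Q i = 0.
  move=> es_e.
  have : ('X - a%:P) ^+ (e - n) *
      \sum_(i < n.+1) (e ^_ i)%:R *: (P i * ('X - a%:P) ^+ (n - i)) = 0.
    rewrite -[RHS](es0 _ es_e) /diffop mulr_sumr; apply: eq_bigr => i _.
    rewrite derivn_XsubC_exp mulrnAr -scalerAr scaler_nat mulrCA -exprD.
    congr (_ * _ ^+ _ *+ _); have := ltn_ord i; have := le_n _ es_e; lia.
  move/eqP; rewrite mulf_eq0 expf_eq0 polyXsubC_eq0 andbF /= => /eqP.
  move/(congr1 (fun p => p \Po ('X + a%:P))); rewrite comp_poly0 => shift0.
  rewrite -[RHS]shift0 rmorph_sum; apply: eq_bigr => i _ /=.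
  by rewrite comp_polyZ rmorphM /= XsubC_shift.
have coefQ v i : (v < size es)%N -> (i < n.+1)%N -> (Q i)`_v = 0.
  move=> lt_v lt_i.
  have Qv j : (j < n - v)%N -> (Q j)`_v = 0.
    by move=> lt_j; rewrite coefMXn; case: ltnP => //; lia.
  (* The exponents are all >= n, hence distinct from these extra roots. *)
  apply: (ffact_comb_eq0 charK0 (n := n.+1) (c := fun j => (Q j)`_v)
            (zs := iota 0 (n - v) ++ es)) => //.
  - rewrite cat_uniq iota_uniq uniq_es andbT /=; apply/hasPn => e /le_n le_ne.
    by rewrite mem_iota; lia.
  - by rewrite size_cat size_iota; lia.
  move=> z; rewrite mem_cat mem_iota add0n /= => /orP [lt_z|es_z].
    apply: big1 => j _; have [lt_zj|le_jz] := ltnP z j.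
      by rewrite ffact_small ?mulr0.
    by rewrite Qv ?mul0r //; lia.
  have := congr1 (fun p : {poly K} => p`_v) (Q0 _ es_z).
  rewrite coef0 coef_sum => Qv0; rewrite -[RHS]Qv0; apply: eq_bigr => j _.
  by rewrite coefZ mulrC.
rewrite -[P n](comp_polyXaddC_K _ a).
have -> : P n \Po ('X + a%:P) = drop_poly (size es) (Q n) * 'X^(size es).
  rewrite -[LHS]mulr1 -(expr0 'X) -[X in 'X^X](subnn n) -/(Q n).
  rewrite -[LHS](poly_take_drop (size es)) [take_poly _ _](_ : _ = 0) ?add0r //.
  apply/polyP => v; rewrite coef_take_poly coef0.
  by case: ifP => // lt_v; apply: coefQ.
by rewrite rmorphM /= comp_Xn_poly dvdp_mulIr.
Qed.

Lemma size_multiroots_lt (K : fieldType) (p : {poly K}) (r : seq K) :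
  p != 0 -> (forall a, ('X - a%:P) ^+ count_mem a r %| p) ->
  (size r < size p)%N.
Proof.
elim: r p => [|a r IHr] p p_neq0 r_dvd; first by rewrite size_poly_gt0.
have /dvdpP [q pE] : 'X - a%:P %| p.
  by apply: dvdp_trans (r_dvd a); rewrite /= eqxx exprS dvdp_mulIl.
have q_neq0 : q != 0 by apply: contraNneq p_neq0 => q0; rewrite pE q0 mul0r.
rewrite pE size_Mmonic ?monicXsubC // size_XsubC addn2 /= ltnS.
apply: IHr => // b; have := r_dvd b; rewrite pE /=.
have [->|neq_ab] := eqVneq a b.
  by rewrite add1n exprSr dvdp_mul2r ?polyXsubC_eq0.
rewrite add0n mulrC Gauss_dvdpr //.
by rewrite coprimep_expl // coprimep_XsubC2 // subr_eq0.
Qed.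

(** Each member with exponent at least n contributes its node as a root of the
leading coefficient [P n], with multiplicity. *)
Lemma card_solutions_lt (K : fieldType) (charK0 : [pchar K] =i pred0)
    (s : nat) (a : 'I_s -> K) (e : 'I_s -> nat)
    (distinct : injective (fun i : 'I_s => (a i, e i)))
    (n : nat) (P : nat -> {poly K}) :
  P n != 0 -> (forall i, diffop n.+1 P (('X - (a i)%:P) ^+ e i) = 0) ->
  (s < #|[set i | (e i < n)%N]| + size (P n))%N.
Proof.
move=> Pn_neq0 F0; pose H := [set i | (n <= e i)%N].
have sE : (s = #|[set i | (e i < n)%N]| + #|H|)%N.
  rewrite -[LHS]card_ord -(cardC [set i | (e i < n)%N]); congr (_ + _)%N.
  by apply: eq_card => i; rewrite !inE -leqNgt.
rewrite [ltnLHS]sE ltn_add2l cardE -(size_map a).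
apply: size_multiroots_lt => // b.
pose es := [seq e i | i <- enum H & a i == b].
have -> : count_mem b [seq a i | i <- enum H] = size es.
  by rewrite count_map size_map size_filter.
have esP x : x \in es -> exists i, [/\ x = e i, a i = b & (n <= e i)%N].
  case/mapP=> i; rewrite mem_filter mem_enum inE => /andP[/eqP aib le_n] ->.
  by exists i.
apply: exp_dvdp_lead => // [|x /esP [i [-> _]] //|x /esP [i [-> <- _]] //].
rewrite map_inj_in_uniq; first by rewrite !filter_uniq // -enumT enum_uniq.
move=> i j.
rewrite !mem_filter => /andP[/eqP ai _] /andP[/eqP aj _] eij.
by apply: distinct; rewrite /= ai aj eij.
Qed.

(** * The dimension bound *)

(** The minimum is its first argument for i <= k and its second one from k on.
Pairing i < k with i + k gives the constant 3k + 2, and i = 2k gives k + 1. *)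
Lemma sum_size_bounds k :
  (k * (2 * k + k).+1 <
     \sum_(i < (2 * k).+1) minn (i + k.+1) ((3 * k).+1 - i))%N.
Proof.
rewrite -(big_mkord xpredT (fun i => minn (i + k.+1) ((3 * k).+1 - i))).
rewrite (big_cat_nat _ (n := k)) //=; last by lia.
rewrite -[X in (_ + \sum_(X <= i < _) _)%N]add0n big_addn.
rewrite (_ : (2 * k).+1 - k = k.+1)%N; last by lia.
rewrite big_nat_recr //= addnA -big_split /=.
rewrite (eq_big_nat _ _ (F2 := fun=> (3 * k).+2)); last by move=> i; lia.
rewrite sum_nat_const_nat; lia.
Qed.

(** The order 2k and the degree excess k, together with the target 3k, are chosen
so that the unknowns just outnumber the equations: both counts are 3k^2 up to
lower-order terms. *)
Lemma card_le_3dim (K : fieldType) (charK0 : [pchar K] =i pred0)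
    (s : nat) (a : 'I_s -> K) (e : 'I_s -> nat)
    (distinct : injective (fun i : 'I_s => (a i, e i)))
    (polya : polya_condition e) :
  (s <= 3 * dim_poly_span (shifted_powers a e))%N.
Proof.
set F := shifted_powers a e; set k := dim_poly_span F; set N := max_size F.
pose f i := ('X - (a i)%:P) ^+ e i.
have [J [freeJ spanJ]] := free_subfamily (fun i => npolyp N (f i)) (enum 'I_s).
have sizeJ : size J = k.
  rewrite -(size_map (fun i => npolyp N (f i))) -(eqP freeJ) spanJ.
  by congr (\dim <<_>>)%VS; apply: (map_comp (npolyp N) f).
have fK i : npolyp N (f i) = f i :> {poly K}.
  by apply: max_size_npolypK; apply: codom_f.
pose fs := [seq (a i, e i) | i <- J].
pose d i := minn (i + k.+1) ((3 * k).+1 - i).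
have le_d i : (d i <= i + k.+1)%N by apply: geq_minl.
have lt_fs : (size fs * (2 * k + k).+1 < \sum_(i < (2 * k).+1) d i)%N.
  by rewrite size_map sizeJ sum_size_bounds.
have [P [sizeP [i0 Pi0] fs0]] := exists_annihilator le_d lt_fs.
have F0 i : diffop (2 * k).+1 P (f i) = 0.
  have : npolyp N (f i) \in <<[seq npolyp N (f j) | j <- J]>>%VS.
    rewrite spanJ; apply: memv_span.
    by apply: (map_f (fun j => npolyp N (f j))); rewrite mem_enum.
  move/(coord_span (X := in_tuple _))/(congr1 (@polyn _ _)).
  rewrite fK => ->; rewrite raddf_sum /=.
  rewrite diffop_comb big1 // => j _.
  have lt_j : (j < size J)%N by rewrite -(size_map (fun i => npolyp N (f i))).
  by rewrite (nth_map i) // fK fs0 ?scaler0 // map_f ?mem_nth.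
(* n is the actual order of the annihilator. *)
pose n : 'I_(2 * k).+1 := [arg max_(i > i0 | P i != 0) i].
have [Pn_neq0 Pn_max] :
    P n != 0 /\ forall i : 'I_(2 * k).+1, P i != 0 -> (i <= n)%N.
  by rewrite /n; case: arg_maxnP.
have Fn0 i : diffop n.+1 P (f i) = 0.
  rewrite -[RHS](F0 i) /diffop.
  rewrite (big_ord_widen _ (fun j => P j * (f i)^`(j)) (ltn_ord n)).
  rewrite big_mkcond /=; apply: eq_bigr => j _; rewrite ltnS.
  case: leqP => // lt_nj.
  have [->|/Pn_max] := eqVneq (P j) 0; first by rewrite mul0r.
  by rewrite leqNgt lt_nj.
have lt_s := card_solutions_lt charK0 distinct Pn_neq0 Fn0.
have := leq_trans lt_s (leq_add (polya n) (leq_trans (sizeP n) (geq_minr _ _))).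
by rewrite subnKC // ltnW // (leq_trans (ltn_ord n)) // ltnS leq_mul2r orbT.
Qed.

Theorem theorem4p8 (R : rcfType) (K : fieldType) (charK0 : [pchar K] =i pred0)
    (s : nat) (hs : (1 <= s)%N) (a : 'I_s -> K) (e : 'I_s -> nat)
    (distinct : injective (fun i : 'I_s => (a i, e i)))
    (polya : polya_condition e) :
  (1 - Num.sqrt 2%:R / 2%:R) * (s%:R - 1) <=
    (dim_poly_span (shifted_powers a e))%:R :> R.
Proof.
have := card_le_3dim charK0 distinct polya.
move: (dim_poly_span _) => k; rewrite -(ler_nat R) natrM => le_s3k.
have s_ge1 : 1 <= s%:R :> R by rewrite ler1n.
have sqrt2_ge : 4%:R / 3%:R <= Num.sqrt 2%:R :> R.
  by rewrite -[leLHS]ger0_norm ?divr_ge0 // -sqrtr_sqr ler_sqrt //; lra.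
have : (1 - Num.sqrt 2%:R / 2%:R) * (s%:R - 1) <= 1 / 3%:R * (s%:R - 1) :> R.
  by apply: ler_wpM2r; lra.
lra.
Qed.
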